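(* Let $\theta$ be a rotation angle, $p\in[0,1]$ the error probability, and consider the two-qubit channel $\mathcal{N}_{\mathcal{ZZ}}=(1-p)\mathcal{R}_{ZZ}(\theta)+p\,\mathcal{ZZ}\circ\mathcal{R}_{ZZ}(\theta)$. Let $$\varphi=\arcsin[(1-2p)\sin\theta],\qquad s=\frac12\left(1+(1-2p)\frac{\cos\theta}{\cos\varphi}\right).$$ Then $\mathcal{N}_{\mathcal{ZZ}}$ has the optimal decomposition (with respect to the channel extent) $$\mathcal{N}_{\mathcal{ZZ}}=s\,\mathcal{R}_{ZZ}(\varphi)+(1-s)\,\mathcal{R}_{ZZ}(\pi-\varphi)$$ and channel extent $$\Xi(\mathcal{N}_{\mathcal{ZZ}})=1+|\sin\varphi|=1+(1-2p)|\sin\theta| .$$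
   Context: Channels: $\mathcal{R}_{ZZ}(\vartheta)(\cdot)=R_{ZZ}(\vartheta)(\cdot)R_{ZZ}(\vartheta)^\dagger$ with $R_{ZZ}(\vartheta)=e^{-i\vartheta Z\otimes Z/2}$; $\mathcal{ZZ}(\cdot)=(Z\otimes Z)(\cdot)(Z\otimes Z)$. On $n$ qubits let $c_{2j-1}=Z^{\otimes(j-1)}\otimes X\otimes I^{\otimes(n-j)}$ and $c_{2j}=Z^{\otimes(j-1)}\otimes Y\otimes I^{\otimes(n-j)}$, $j=1,\dots,n$. The set $G_n$ of Gaussian unitaries consists of the $n$-qubit unitaries $V$ for which there is $R\in O(2n)$ with $Vc_jV^\dagger=\sum_kR_{j,k}c_k$ for all $j$. The unitary extent of an $n$-qubit unitary $U$ is $\xi(U)=\min\{\|c\|_1^2: U=\sum_{j}c_jK_j,\ K_j\in G_n,\ c_j\in\mathbb{C}\}$ (finite sums). For a channel $\mathcal{E}$ that is a convex combination of unitary channels, the channel extent is $\Xi(\mathcal{E})=\min\{\sum_jp_j\xi(V_j):\mathcal{E}=\sum_jp_j\mathcal{V}_j,\ \mathcal{V}_j(\cdot)=V_j(\cdot)V_j^\dagger,\ V_j\text{ unitary},\ p_j\ge0,\ \sum_jp_j=1\}$. A decomposition attaining the minimum is called optimal.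
   Formalization: The printed last equality fails for p>1/2 with sin θ≠0 (p=1, θ=π/2 gives 2 versus 0); it is proved as 1+|sin φ| = 1+|1-2p||sin θ| for all p, and as printed for p≤1/2. When cos φ=0, where s is undefined, s is taken to be 1/2. *)

(* Defs.v *)
From HB Require Import structures.
From mathcomp Require Import all_boot all_order all_algebra.
From mathcomp Require Import all_classical all_reals all_analysis.
From mathcomp Require Import complex mxtens.

Set Implicit Arguments.
Unset Strict Implicit.
Unset Printing Implicit Defensive.

Import Order.TTheory GRing.Theory Num.Theory numFieldNormedType.Exports.

Local Open Scope classical_set_scope.
Local Open Scope ring_scope.
Local Open Scope complex_scope.
Local Open Scope sesquilinear_scope.

Section Pauli.
Variable R : realType.

Definition pauliX : 'M[R[i]]_2 := \matrix_(i, j) (i != j)%:R.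

Definition pauliY : 'M[R[i]]_2 :=
  \matrix_(i, j) if i == j then 0 else if i == 0 then - 'i%C else 'i%C.

Definition pauliZ : 'M[R[i]]_2 := \matrix_(i, j) ((i == j)%:R * (-1) ^+ i).

(* [2 ^ m.+2] is convertible to [2 * 2 ^ m.+1] (as used in [mxtens.ntensmx]),
   so that no cast is needed; [2 ^ 1] is convertible to [2]. *)
Fixpoint tens_rec m (f : nat -> 'M[R[i]]_2) : 'M[R[i]]_(2 ^ m.+1) :=
  if m is m'.+1 then tensmx (f 0) (tens_rec m' (f \o succn)) else f 0.

(* The n-fold Kronecker product of f 0, f 1, ..., f (n - 1) in this order. *)
Definition tens n (f : nat -> 'M[R[i]]_2) : 'M[R[i]]_(2 ^ n) :=
  if n is m.+1 then tens_rec m f else 1%:M.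

(* Jordan-Wigner operators, numbered from 0: [majorana n i] is c_{i + 1}, which
   acts on qubit i./2 (qubits are numbered from 0 as well) as X when i is even
   and as Y when i is odd. *)
Definition majorana n (i : 'I_(2 * n)) : 'M[R[i]]_(2 ^ n) :=
  tens n (fun k => if (k < i./2)%N then pauliZ
                   else if k == i./2 then (if odd i then pauliY else pauliX)
                   else 1%:M).

End Pauli.

Section Extent.
Variables (R : realType) (n : nat).
Local Notation M := 'M[R[i]]_(2 ^ n).

Definition gaussian (V : M) : Prop :=
  V \is unitarymx /\
  exists2 Q : 'M[R]_(2 * n), Q *m Q^T = 1%:M &
    forall j, V *m majorana R j *m V ^t* = \sum_k (Q j k)%:C *: majorana R k.

Definition gaussian_decomposition (U : M) (w : seq (R[i] * M)) : Prop :=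
  (forall q, q \in w -> gaussian q.2) /\ U = \sum_(q <- w) q.1 *: q.2.

Definition l1norm (w : seq (R[i] * M)) : R := \sum_(q <- w) Normc.normc q.1.

(* The minimum is taken as an infimum in the extended reals: the two agree
   whenever the minimum is attained (lemma [ereal_inf_min] below), and the
   infimum over an empty set of decompositions is +oo. *)
Definition extent (U : M) : \bar R :=
  ereal_inf [set (l1norm w ^+ 2)%:E | w in gaussian_decomposition U].

Definition unitary_channel (V : M) (rho : M) : M := V *m rho *m V ^t*.

Definition mixture_decomposition (E : M -> M) (w : seq (R * M)) : Prop :=
  [/\ forall q, q \in w -> 0 <= q.1 /\ q.2 \is unitarymx,
      \sum_(q <- w) q.1 = 1 &
      forall rho, E rho = \sum_(q <- w) q.1%:C *: unitary_channel q.2 rho].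

Definition mixture_cost (w : seq (R * M)) : \bar R :=
  (\sum_(q <- w) q.1%:E * extent q.2)%E.

(* Same convention as for [extent]. *)
Definition channel_extent (E : M -> M) : \bar R :=
  ereal_inf [set mixture_cost w | w in mixture_decomposition E].

Definition optimal_decomposition (E : M -> M) (w : seq (R * M)) : Prop :=
  mixture_decomposition E w /\ mixture_cost w = channel_extent E.

End Extent.

Lemma ereal_inf_min (R : realType) (A : set (\bar R)) (x : \bar R) :
  A x -> lbound A x -> ereal_inf A = x.
Proof.
move=> Ax lbx; apply/eqP; rewrite eq_le; apply/andP; split.
  exact: ereal_inf_lbound.
exact: le_ereal_inf_tmp.
Qed.

(* The limit in the complex matrices, taken entrywise on real and imaginary
   parts. *)
Definition mxlim (R : realType) n (u : nat -> 'M[R[i]]_n) : 'M[R[i]]_n :=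
  \matrix_(i, j) (limn (fun N => complex.Re (u N i j))
                  +i* limn (fun N => complex.Im (u N i j))).

Definition expmx (R : realType) n (A : 'M[R[i]]_n) : 'M[R[i]]_n :=
  mxlim (fun N => \sum_(0 <= k < N) (k`!%:R)^-1 *: A ^+ k).

Section TwoQubits.
Variable R : realType.

Definition ZZ : 'M[R[i]]_(2 ^ 2) := tensmx (pauliZ R) (pauliZ R).

Definition R_ZZ (t : R) : 'M[R[i]]_(2 ^ 2) := expmx (- 'i%C * (t / 2)%:C *: ZZ).

Definition N_ZZ (theta p : R) (rho : 'M[R[i]]_(2 ^ 2)) : 'M[R[i]]_(2 ^ 2) :=
  (1 - p)%:C *: unitary_channel (n := 2) (R_ZZ theta) rho
  + p%:C *: (unitary_channel (n := 2) ZZ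
             \o unitary_channel (n := 2) (R_ZZ theta)) rho.

End TwoQubits.

(* Main.v *)
(* The witness functional is W(V) = tr((1 + w Z(x)Z) V) / 4 with w = i or -i.
   A Gaussian K satisfies |W(K)| <= 1: the antiunitary A |-> J A^* J with
   J = X(x)Y fixes every Majorana operator, so J K^* J induces the same real
   linear map as K and is a multiple of K by Schur's lemma; as J also fixes
   Z(x)Z, tr K and tr(Z(x)Z K) have a real relative phase, the cross terms of
   |W(K)|^2 cancel, and Bessel's inequality for the orthogonal pair 1, Z(x)Z
   bounds the rest.  Hence |W(V)|^2 <= xi(V) for every V.  Moreover
   sum_j p_j |W(V_j)|^2 is a linear function of the channel, so evaluating it on
   the claimed decomposition, with the sign of w matching that of sin phi, bounds
   the cost of every other decomposition from below. *)

Require Import Defs.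
From mathcomp Require Import all_boot all_order all_algebra.
From mathcomp Require Import all_classical all_reals all_analysis.
From mathcomp Require Import complex mxtens ring lra.
Set Implicit Arguments.
Unset Strict Implicit.
Unset Printing Implicit Defensive.
Import Order.TTheory GRing.Theory Num.Theory numFieldNormedType.Exports.
Local Open Scope ring_scope.

(** * Algebra of the Pauli matrices *)

Section Paulis.
Local Open Scope classical_set_scope.
Local Open Scope ring_scope.
Local Open Scope complex_scope.
Local Open Scope sesquilinear_scope.
Variable R : realType.
Local Notation C := R[i].
Local Notation X := (pauliX R).
Local Notation Y := (pauliY R).
Local Notation Z := (pauliZ R).

Ltac mx2 := apply/matrixP=> -[[|[|//]] ?] [[|[|//]] ?];
  rewrite !(mxE, big_ord_recl, big_ord0) /= ?expr0 ?expr1; simpc => //.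

Lemma mulXX : X *m X = 1%:M. Proof. mx2. Qed.
Lemma mulYY : Y *m Y = 1%:M. Proof. mx2. Qed.
Lemma mulZZ : Z *m Z = 1%:M. Proof. mx2. Qed.
Lemma mulXY : X *m Y = 'i%C *: Z. Proof. mx2. Qed.
Lemma mulYX : Y *m X = - 'i%C *: Z. Proof. mx2. Qed.
Lemma mulZX : Z *m X = 'i%C *: Y. Proof. mx2. Qed.
Lemma mulXZ : X *m Z = - 'i%C *: Y. Proof. mx2. Qed.
Lemma mulZY : Z *m Y = - 'i%C *: X. Proof. mx2. Qed.
Lemma mulYZ : Y *m Z = 'i%C *: X. Proof. mx2. Qed.
Lemma conjE (z : C) : Num.conj z = conjc z. Proof. by []. Qed.
Lemma conjX : map_mx Num.conj X = X. Proof. mx2; by rewrite conjE; simpc. Qed.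
Lemma conjY : map_mx Num.conj Y = - Y. Proof. mx2; by rewrite conjE; simpc. Qed.
Lemma conjZ : map_mx Num.conj Z = Z. Proof. mx2; by rewrite conjE; simpc. Qed.
Lemma trmxZ : Z^T = Z. Proof. mx2. Qed.
(** The matrix (1 + Z) / 2 projects on the first basis vector, and X moves that vector to the
    second. *)
Lemma delta0 (a : 'I_2) :
  delta_mx a 0 = 2^-1 *: ((if a == 0 then 1%:M else X) *m (1%:M + Z)) :> 'M[C]_2.
Proof.
have h : (2^-1 : C) * (1+1) = 1 by rewrite mulVf // pnatr_eq0.
(* Generalizing [2^-1] keeps simplification from unfolding the complex inverse. *)
move: (2^-1) h => c h; case: a => -[|[|//]] ? /=; mx2.
all: rewrite ?(mulr1, mulr0, mul0r, mul1r, addr0, add0r, subrr).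
all: rewrite -?[(1 + 1) +i* 0]/((1 + 1)%:C) ?rmorphD ?h //.
Qed.

End Paulis.

(** * Two-qubit Kronecker products and the commutant of the Majorana operators *)

Section Tensors.
Local Open Scope classical_set_scope.
Local Open Scope ring_scope.
Local Open Scope complex_scope.
Local Open Scope sesquilinear_scope.
Variable R : realType.
Local Notation C := R[i].
Local Notation X := (pauliX R).
Local Notation Y := (pauliY R).
Local Notation Z := (pauliZ R).
Local Notation M := 'M[C]_(2 ^ 2).

(* [tensmx] retyped from ['M_(2 * 2)] to the convertible ['M_(2 ^ 2)]. *)
Definition tens2 (A B : 'M[C]_2) : M := tensmx A B.

Lemma tens2M A B A' B' : tens2 A B *m tens2 A' B' = tens2 (A *m A') (B *m B').
Proof. by rewrite [LHS](@tensmx_mul _ 2 2 2 2 2 2). Qed.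

Lemma tens2Zl a A B : tens2 (a *: A) B = a *: tens2 A B.
Proof. by apply/matrixP=> i j; rewrite !mxE mulrA. Qed.

Lemma tens2Zr a A B : tens2 A (a *: B) = a *: tens2 A B.
Proof. by apply/matrixP=> i j; rewrite !mxE mulrCA. Qed.

Lemma tens2Nl A B : tens2 (- A) B = - tens2 A B.
Proof. by rewrite -scaleN1r tens2Zl scaleN1r. Qed.

Lemma tens2Nr A B : tens2 A (- B) = - tens2 A B.
Proof. by rewrite -scaleN1r tens2Zr scaleN1r. Qed.

Lemma tens2Dl A A' B : tens2 (A + A') B = tens2 A B + tens2 A' B.
Proof. by apply/matrixP=> i j; rewrite !mxE mulrDl. Qed.

Lemma tens2Dr A B B' : tens2 A (B + B') = tens2 A B + tens2 A B'.
Proof. by apply/matrixP=> i j; rewrite !mxE mulrDr. Qed.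

Lemma tens2_conj A B :
  map_mx Num.conj (tens2 A B) = tens2 (map_mx Num.conj A) (map_mx Num.conj B).
Proof. by apply/matrixP=> i j; rewrite !mxE rmorphM. Qed.

Lemma tens2_tr A B : (tens2 A B)^T = tens2 A^T B^T.
Proof. by apply/matrixP=> i j; rewrite !mxE. Qed.

Lemma tens2_1 : tens2 1%:M 1%:M = 1%:M.
Proof. apply/matrixP => i j.
case: (mxtens_indexP i) => i0 i1; case: (mxtens_indexP j) => j0 j1.
by rewrite [LHS]tensmxE !mxE -natrM mulnb (can_eq (@mxtens_indexK 2 2)). Qed.

Lemma tens2_delta (a b c d : 'I_2) :
  tens2 (delta_mx a c) (delta_mx b d) =
    delta_mx (mxtens_index (a, b)) (mxtens_index (c, d)).
Proof.
apply/matrixP => i j.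
case: (mxtens_indexP i) => i0 i1; case: (mxtens_indexP j) => j0 j1.
rewrite [LHS]tensmxE !mxE -natrM mulnb.
rewrite !(can_eq (@mxtens_indexK 2 2)) !xpair_eqE; congr (nat_of_bool _)%:R.
by rewrite andbACA.
Qed.

Definition majorana2 (j : nat) : M :=
  nth 0 [:: tens2 X 1%:M; tens2 Y 1%:M; tens2 Z X; tens2 Z Y] j.

Lemma majorana2E (j : 'I_(2 * 2)) : majorana R j = majorana2 j.
Proof. by case: j => -[|[|[|[|//]]]]. Qed.

(** At entry (k, i0) the hypothesis for i says that [W k i] is [W i0 i0] if k = i and 0 otherwise,
    so one column of matrix units suffices. *)
Lemma scalar_mx_comm_delta (S : nzRingType) n (W : 'M[S]_n) (i0 : 'I_n) :
  (forall i, W *m delta_mx i i0 = delta_mx i i0 *m W) -> W = (W i0 i0)%:M.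
Proof.
move=> comm; apply/matrixP => k i.
have /matrixP/(_ k i0) := comm i.
rewrite !mxE (bigD1 i) //= big1 => [|l /negPf nl]; last by rewrite mxE nl mulr0.
rewrite (bigD1 i0) //= big1 => [|l /negPf nl]; last by rewrite mxE nl andbF mul0r.
by rewrite !mxE !eqxx mulr1 !addr0 andbT mulr_natl => ->.
Qed.

(** Schur's lemma made concrete: the matrices commuting with [W] form an algebra, the Majorana
    operators generate the Paulis on each qubit, and these give a column of matrix units. *)
Lemma scalar_mx_comm_majorana (W : M) :
  (forall j, W *m majorana R j = majorana R j *m W) -> exists l, W = l%:M.
Proof.
move=> comm.
have ci : 'i%C != 0 :> C by rewrite eq_complex /= oner_eq0 andbF.
pose cm (A : M) := W *m A = A *m W.
have cmM A B : cm A -> cm B -> cm (A *m B).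
  by move=> cA cB; rewrite /cm mulmxA cA -!mulmxA cB.
have cmZ a A : cm A -> cm (a *: A) by move=> cA; rewrite /cm -scalemxAl -scalemxAr cA.
have cmD A B : cm A -> cm B -> cm (A + B).
  by move=> cA cB; rewrite /cm mulmxDr mulmxDl cA cB.
have cm1 : cm 1%:M by rewrite /cm mulmx1 mul1mx.
have cmj (j : 'I_(2 * 2)) : cm (majorana2 j) by rewrite -majorana2E; exact: comm.
have cX1 : cm (tens2 X 1%:M) := cmj (@Ordinal (2 * 2) 0 isT).
have cY1 : cm (tens2 Y 1%:M) := cmj (@Ordinal (2 * 2) 1 isT).
have cZX : cm (tens2 Z X) := cmj (@Ordinal (2 * 2) 2 isT).
have cZY : cm (tens2 Z Y) := cmj (@Ordinal (2 * 2) 3 isT).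
have cZ1 : cm (tens2 Z 1%:M).
  have -> : Z = 'i%C^-1 *: (X *m Y) by rewrite mulXY scalerA mulVf // scale1r.
  by rewrite tens2Zl -(mulmx1 1%:M) -tens2M; apply/cmZ/cmM.
(* Multiplication by Z on the first qubit strips the Jordan-Wigner string. *)
have c1X : cm (tens2 1%:M X).
  have -> : tens2 1%:M X = tens2 Z 1%:M *m tens2 Z X by rewrite tens2M mulZZ mul1mx.
  exact: cmM.
have c1Y : cm (tens2 1%:M Y).
  have -> : tens2 1%:M Y = tens2 Z 1%:M *m tens2 Z Y by rewrite tens2M mulZZ mul1mx.
  exact: cmM.
have c1Z : cm (tens2 1%:M Z).
  have -> : Z = 'i%C^-1 *: (X *m Y) by rewrite mulXY scalerA mulVf // scale1r.
  by rewrite tens2Zr -(mulmx1 1%:M) -tens2M; apply/cmZ/cmM.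
have cA1 a : cm (tens2 (delta_mx a 0) 1%:M).
  rewrite delta0 tens2Zl; apply: cmZ.
  have -> A B : tens2 (A *m B) 1%:M = tens2 A 1%:M *m tens2 B 1%:M.
    by rewrite tens2M mulmx1.
  apply: cmM; first by case: ifP; rewrite ?tens2_1.
  by rewrite tens2Dl tens2_1; apply: cmD.
have c1A a : cm (tens2 1%:M (delta_mx a 0)).
  rewrite delta0 tens2Zr; apply: cmZ.
  have -> A B : tens2 1%:M (A *m B) = tens2 1%:M A *m tens2 1%:M B.
    by rewrite tens2M mulmx1.
  apply: cmM; first by case: ifP; rewrite ?tens2_1.
  by rewrite tens2Dr tens2_1; apply: cmD.
eexists; apply: (@scalar_mx_comm_delta C (2 ^ 2) W (mxtens_index (0, 0))) => i.
case: (mxtens_indexP i) => a b.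
rewrite -tens2_delta.
have -> A B : tens2 A B = tens2 A 1%:M *m tens2 1%:M B.
  by rewrite tens2M mulmx1 mul1mx.
exact: (cmM _ _ (cA1 a) (c1A b)).
Qed.

End Tensors.

(** * Parity, the antiunitary symmetry and traces of Gaussian unitaries *)

Section Witness.
Local Open Scope classical_set_scope.
Local Open Scope ring_scope.
Local Open Scope complex_scope.
Local Open Scope sesquilinear_scope.
Variable R : realType.
Local Notation C := R[i].
Local Notation X := (pauliX R).
Local Notation Y := (pauliY R).
Local Notation Z := (pauliZ R).
Local Notation M := 'M[C]_(2 ^ 2).
Local Notation ZZ := (ZZ R).

Lemma mulZZZZ : ZZ *m ZZ = 1%:M.
Proof. by rewrite [LHS]tens2M !mulZZ tens2_1. Qed.

Lemma conjtr_ZZ : ZZ^t* = ZZ.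
Proof. by rewrite (tens2_tr Z Z) tens2_conj trmxZ conjZ. Qed.

(** [ZZ] is, up to sign, the product of all four Majorana operators, that is, the fermion parity. *)
Lemma ZZ_majorana (j : 'I_(2 * 2)) : ZZ *m majorana R j = - (majorana R j *m ZZ).
Proof.
rewrite majorana2E; have -> : ZZ = tens2 Z Z by [].
by case: j => -[|[|[|[|//]]]] ? /=; rewrite !tens2M ?mulmx1 ?mul1mx
  ?(mulZX, mulXZ, mulZY, mulYZ, mulZZ) !(tens2Zl, tens2Zr) !scaleNr ?opprK.
Qed.

Lemma majorana_sqr (j : 'I_(2 * 2)) : majorana R j *m majorana R j = 1%:M.
Proof.
rewrite majorana2E.
by case: j => -[|[|[|[|//]]]] ? /=;
  rewrite !tens2M ?(mulXX, mulYY, mulZZ) ?mulmx1 tens2_1.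
Qed.

(** Conjugation by a Majorana operator negates [ZZ] but preserves its trace. *)
Lemma mxtrace_ZZ : \tr ZZ = 0.
Proof.
pose j := @Ordinal (2 * 2) 0 isT.
have : \tr ZZ = - \tr ZZ.
  rewrite -[in LHS](mulmx1 ZZ) -(majorana_sqr j) mulmxA ZZ_majorana.
  rewrite mulNmx -scaleN1r mxtraceZ mulN1r.
  by rewrite mxtrace_mulC mulmxA majorana_sqr mul1mx.
by move/eqP; rewrite -addr_eq0 -mulr2n mulrn_eq0 => /eqP.
Qed.

(* [twist] is the operator J of the header. *)
Definition twist : M := tens2 X Y.

Lemma twist_sqr : twist *m twist = 1%:M.
Proof. by rewrite tens2M mulXX mulYY tens2_1. Qed.

Lemma twist_ZZ : twist *m ZZ *m twist = ZZ.
Proof.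
have -> : ZZ = tens2 Z Z by [].
rewrite !tens2M mulXZ mulYZ -!scalemxAl mulYX mulXY !(tens2Zl, tens2Zr) !scalerA.
have -> : - 'i%C * 'i%C * 'i%C * - 'i%C = ('i%C ^+ 2) ^+ 2 :> C by ring.
by rewrite sqr_i sqrrN expr1n scale1r.
Qed.

(** Complex conjugation negates the Majorana operators with a factor Y, and these are exactly the
    ones that anticommute with [twist]. *)
Lemma twist_majorana (j : 'I_(2 * 2)) :
  twist *m map_mx Num.conj (majorana R j) *m twist = majorana R j.
Proof.
rewrite majorana2E.
case: j => -[|[|[|[|//]]]] ? /=; rewrite tens2_conj ?map_mx1 ?conjX ?conjY ?conjZ.
- by rewrite !tens2M mulmx1 mulXX mul1mx mulYY.
- rewrite !tens2M mulmx1 mulYY mulmxN mulXY mulNmx -scalemxAl mulZX.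
  by rewrite scalerA -expr2 sqr_i scaleN1r opprK.
- rewrite !tens2M mulXZ mulYX -!scalemxAl mulYX mulZY !scalerA !mulNr mulrN.
  by rewrite opprK -!expr2 sqr_i !scaleN1r tens2Nl tens2Nr opprK.
- rewrite !tens2M mulXZ mulmxN mulYY -!scalemxAl mulNmx mul1mx mulYX !scalerA.
  by rewrite mulNr mulrN opprK -expr2 sqr_i scaleN1r tens2Nl tens2Nr opprK.
Qed.

Lemma gaussian_conj (K : M) : gaussian K ->
  exists l, twist *m map_mx Num.conj K *m twist = l *: K.
Proof.
case=> /unitarymxP KK [Q _ KQ].
have KK' : K^t* *m K = 1%:M := mulmx1C KK.
set Kt := _ *m twist.
pose S j := \sum_k (Q j k)%:C *: majorana R k.
have Kc j : K *m majorana R j = S j *m K.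
  by rewrite -[S j]KQ -mulmxA KK' mulmx1.
(* The entries of [Q] are real, so twisted conjugation fixes [S j] as well; applied to [Kc] it
   yields the same relation for [Kt]. *)
have JS j : twist *m map_mx Num.conj (S j) *m twist = S j.
  rewrite /S raddf_sum mulmx_sumr mulmx_suml; apply: eq_bigr => k _ /=.
  rewrite map_mxZ -scalemxAr -scalemxAl twist_majorana; congr (_ *: _).
  exact: conjc_real.
have Ktc j : Kt *m majorana R j = S j *m Kt.
  rewrite -{1}twist_majorana -[in RHS]JS /Kt !mulmxA.
  rewrite -(mulmxA _ twist twist) twist_sqr mulmx1.
  rewrite -(mulmxA _ twist twist) twist_sqr mulmx1.
  by rewrite -!(mulmxA twist) -!map_mxM Kc.
have [l Wl] : exists l, K^t* *m Kt = l%:M.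
  apply: scalar_mx_comm_majorana => j.
  by rewrite -mulmxA Ktc -[S j]KQ !mulmxA KK' mul1mx.
exists l.
by rewrite -[LHS]mul1mx -KK -mulmxA Wl mul_mx_scalar.
Qed.

(** Conjugating either trace multiplies it by the same factor [l] from [gaussian_conj], so both
    sides are [l] times the product of the two traces. *)
Lemma gaussian_trace_real (K : M) : gaussian K ->
  Num.conj (\tr K) * \tr (ZZ *m K) = \tr K * Num.conj (\tr (ZZ *m K)).
Proof.
case/gaussian_conj => l Kl.
have -> : Num.conj (\tr K) = l * \tr K.
  rewrite -mxtraceZ -Kl mxtrace_mulC mulmxA twist_sqr mul1mx.
  by rewrite /mxtrace rmorph_sum; apply: eq_bigr => i _; rewrite mxE.
have -> : Num.conj (\tr (ZZ *m K)) = l * \tr (ZZ *m K).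
  rewrite -mxtraceZ scalemxAr -Kl 2!mulmxA [in RHS]mxtrace_mulC 2!mulmxA twist_ZZ.
  have {2}-> : ZZ = map_mx Num.conj ZZ by rewrite (tens2_conj Z Z) conjZ.
  by rewrite -map_mxM /mxtrace rmorph_sum; apply: eq_bigr => i _; rewrite [RHS]mxE.
by rewrite mulrCA mulrA.
Qed.

Lemma mxtrace_conjtr n (A : 'M[C]_n) : \tr (A^t*) = Num.conj (\tr A).
Proof.
by rewrite /mxtrace rmorph_sum; apply: eq_bigr => i _; rewrite !mxE.
Qed.

Lemma mxtrace_mul_conjtr_ge0 m n (A : 'M[C]_(m, n)) : 0 <= \tr (A *m A^t*).
Proof.
apply: sumr_ge0 => i _; rewrite mxE; apply: sumr_ge0 => j _; rewrite !mxE.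
exact: mul_conjC_ge0.
Qed.

Lemma conjtrD m n (A B : 'M[C]_(m, n)) : (A + B)^t* = A^t* + B^t*.
Proof. by rewrite linearD map_mxD. Qed.
Lemma conjtrZ m n a (A : 'M[C]_(m, n)) : (a *: A)^t* = Num.conj a *: A^t*.
Proof. by rewrite linearZ map_mxZ. Qed.
Lemma conjtrM m n l (A : 'M[C]_(m, n)) (B : 'M[C]_(n, l)) : (A *m B)^t* = B^t* *m A^t*.
Proof. by rewrite trmx_mul map_mxM. Qed.
Lemma conjtr1 n : (1%:M : 'M[C]_n)^t* = 1%:M.
Proof. by rewrite trmx1 map_mx1. Qed.

(** In the Hilbert-Schmidt product 1 and P are orthogonal of squared norm n. With a and b the two
    traces, the residual n K - a 1 - b P has squared norm n (n^2 - |a|^2 - |b|^2). *)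
Lemma unitary_bessel n (P K : 'M[C]_n) : (0 < n)%N ->
  P^t* = P -> P *m P = 1%:M -> \tr P = 0 -> K \is unitarymx ->
  \tr K * Num.conj (\tr K) + \tr (P *m K) * Num.conj (\tr (P *m K)) <= n%:R ^+ 2.
Proof.
move=> n0 Pc PP trP /unitarymxP KK; set a := \tr K; set b := \tr (P *m K).
have := mxtrace_mul_conjtr_ge0 (n%:R *: K + (- a) *: 1%:M + (- b) *: P).
rewrite !conjtrD !conjtrZ Pc conjtr1.
have trPK : \tr (P *m K^t*) = Num.conj b.
  by rewrite -mxtrace_conjtr conjtrM Pc mxtrace_mulC.
have := mxtrace_conjtr K; move: (K^t*) KK trPK => L KL trPL trL.
rewrite !(mulmxDl, mulmxDr) -!scalemxAl -!scalemxAr.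
rewrite !mulmx1 !mul1mx KL PP !mxtraceD !mxtraceZ.
have -> : \tr (K *m P) = b by rewrite mxtrace_mulC.
rewrite trPL trL trP mxtrace1 -/a.
have -> : Num.conj (n%:R : C) = n%:R by rewrite rmorph_nat.
rewrite !rmorphN /=.
set x := (X in 0 <= X).
have -> : x = n%:R * (n%:R ^+ 2 - (a * Num.conj a + b * Num.conj b)).
  by rewrite /x; ring.
by rewrite pmulr_rge0 ?ltr0n // subr_ge0.
Qed.

(** * The witness functional and its lower bounds *)

Definition witness (w : C) (V : M) : C := \tr (4^-1 *: (1%:M + w *: ZZ) *m V).

Lemma witnessE (w : C) (V : M) : witness w V = 4^-1 * (\tr V + w * \tr (ZZ *m V)).
Proof.
by rewrite /witness -scalemxAl mxtraceZ mulmxDl mul1mx mxtraceD -scalemxAl mxtraceZ.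
Qed.

Lemma gaussian_witness (w : C) (K : M) :
  w ^+ 2 = -1 -> Num.conj w = - w -> gaussian K ->
  `|witness w K| <= 1.
Proof.
move=> w2 wc gK; rewrite -(@ler_pXn2r _ 2) ?nnegrE ?normr_ge0 ?ler01 //.
rewrite normCK expr1n witnessE.
have := gaussian_trace_real gK; have [uK _] := gK.
have := unitary_bessel (isT : (0 < 2 ^ 2)%N) conjtr_ZZ mulZZZZ mxtrace_ZZ uK.
set a := \tr K; set b := \tr _ => le16 ab.
have -> x y : Num.conj (4^-1 * (x + w * y)) = 4^-1 * (Num.conj x - w * Num.conj y).
  by rewrite -mulNr -wc rmorphM fmorphV rmorph_nat rmorphD rmorphM.
set x := (X in X <= 1).
have -> : x = 16^-1 * (a * Num.conj a + b * Num.conj b).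
  (* The last summand holds the cross terms, which [ab] cancels; w^2 = -1 turns the rest into the
     Bessel sum. *)
  have -> : x = 16^-1 * (a * Num.conj a - w ^+ 2 * (b * Num.conj b)
      + w * (Num.conj a * b - a * Num.conj b)) by rewrite /x; field.
  by rewrite ab subrr mulr0 addr0 w2 mulN1r opprK.
by rewrite ler_pdivrMl ?ltr0n // mulr1; apply: le_trans le16 _; rewrite -natrX.
Qed.

Lemma normr_normc (x : C) : `|x| = (Normc.normc x)%:C.
Proof. by []. Qed.

Lemma normc_nneg (x : C) : 0 <= Normc.normc x.
Proof. by rewrite -ler0c -normr_normc. Qed.

(** By linearity and the triangle inequality, a Gaussian decomposition with coefficients c has
    |W(V)| at most the sum of the |c_j|, since each |W(K_j)| is at most 1. *)
Lemma extent_ge (w : C) (V : M) : w ^+ 2 = -1 -> Num.conj w = - w ->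
  ((Normc.normc (witness w V) ^+ 2)%:E <= extent (n := 2) V)%E.
Proof.
move=> w2 wc; apply: le_ereal_inf_tmp => _ [d [gd ->] <-].
rewrite lee_fin ler_pXn2r ?nnegrE //; last 2 first.
- exact: normc_nneg.
- by apply: sumr_ge0 => q _; exact: normc_nneg.
rewrite -lecR -normr_normc /witness mulmx_sumr raddf_sum /=.
apply: le_trans (ler_norm_sum _ _ _) _.
rewrite /l1norm rmorph_sum /=.
rewrite big_seq [X in _ <= X]big_seq; apply: ler_sum => q qd.
rewrite -scalemxAr mxtraceZ normrM -normr_normc ler_piMr //.
exact: gaussian_witness (gd _ qd).
Qed.

(** With D the witness matrix, the (i, j) summand is the diagonal entry (DV)_ii times the conjugate
    of (DV)_jj; the sum is |tr(DV)|^2. This form is linear in the channel. *)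
Lemma witness_channel (w : C) (V : M) :
  (Normc.normc (witness w V) ^+ 2)%:C =
  \sum_i \sum_j ((4^-1 *: (1%:M + w *: ZZ)) *m unitary_channel (n := 2) V (delta_mx i j)
     *m (4^-1 *: (1%:M + w *: ZZ))^t*) i j.
Proof.
rewrite rmorphXn /= -normr_normc normCK /witness.
set D := _ *: _.
have -> : Num.conj (\tr (D *m V)) = \sum_j Num.conj ((D *m V) j j).
  by rewrite rmorph_sum.
rewrite /mxtrace mulr_suml; apply: eq_bigr => i _.
rewrite mulr_sumr; apply: eq_bigr => j _.
rewrite /unitary_channel !mulmxA -mulmxA -conjtrM [RHS]mxE (bigD1 j) //= big1 ?addr0.
  by rewrite [in RHS]mxE (bigD1 i) //= big1 ?addr0 => [|k /negPf ki];
    rewrite !mxE ?eqxx ?mulr1 // ki mulr0.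
move=> k /negPf kj; rewrite mxE big1 ?mul0r // => l _.
by rewrite !mxE kj andbF mulr0.
Qed.

Lemma mxE_scale_mid n (A B D : 'M[C]_n) c i j :
  (A *m (c *: B) *m D) i j = c * (A *m B *m D) i j.
Proof. by rewrite -scalemxAr -scalemxAl mxE. Qed.

(** Both sides equal one expression in [E] alone, evaluated on matrix units. *)
Lemma mixture_witness (w : C) E d d' :
  mixture_decomposition (n := 2) E d -> mixture_decomposition (n := 2) E d' ->
  \sum_(q <- d) q.1 * Normc.normc (witness w q.2) ^+ 2 =
  \sum_(q <- d') q.1 * Normc.normc (witness w q.2) ^+ 2.
Proof.
pose D : M := 4^-1 *: (1%:M + w *: ZZ).
have key d0 : mixture_decomposition (n := 2) E d0 ->
    (\sum_(q <- d0) q.1 * Normc.normc (witness w q.2) ^+ 2)%:C =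
    \sum_i \sum_j (D *m E (delta_mx i j) *m D^t*) i j.
  case=> _ _ Ed; rewrite rmorph_sum /=.
  under eq_bigr do rewrite rmorphM /= witness_channel mulr_sumr.
  rewrite exchange_big /=; apply: eq_bigr => i _.
  under eq_bigr do rewrite mulr_sumr.
  rewrite exchange_big /=; apply: eq_bigr => j _.
  rewrite Ed mulmx_sumr mulmx_suml summxE; apply: eq_bigr => q _.
  exact: (esym (mxE_scale_mid _ _ _ _ _ _)).
by move=> /key h /key; rewrite -h => /complexI.
Qed.

End Witness.

(** * Closed form, channel and extent of the ZZ rotation *)

Section Rotation.
Local Open Scope classical_set_scope.
Local Open Scope ring_scope.
Local Open Scope complex_scope.
Local Open Scope sesquilinear_scope.
Variable R : realType.
Local Notation C := R[i].
Local Notation M := 'M[C]_(2 ^ 2).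
Local Notation ZZ := (ZZ R).

Lemma expr_ZZ (a : C) k :
  (a *: ZZ) ^+ k = a ^+ k *: (if odd k then ZZ else 1%:M).
Proof.
elim: k => [|k IH]; first by rewrite !expr0 scale1r.
rewrite exprS IH -[LHS]/((a *: ZZ) *m _) -scalemxAl -scalemxAr scalerA -exprS /=.
by case: odd => /=; rewrite ?mulZZZZ ?mulmx1.
Qed.

(** As [ZZ] squares to 1, even powers feed the cosine series and odd powers the sine series; for
    each k one of the two coefficients is 0. *)
Lemma exp_term (x : R) k :
  (k`!%:R)^-1 *: (- 'i%C * x%:C *: ZZ) ^+ k =
  (cos_coeff x k)%:C *: 1%:M - ('i%C * (sin_coeff x k)%:C) *: ZZ.
Proof.
have fE (r : R) : ((k`!%:R)^-1 : C) * r%:C = (r / k`!%:R)%:C.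
  by rewrite rmorphM fmorphV rmorph_nat mulrC.
have RM (a b : R) : (a%:C * b%:C : C) = (a * b)%:C by rewrite rmorphM.
rewrite expr_ZZ scalerA exprMn -rmorphXn /= mulrCA fE /cos_coeff /sin_coeff /=.
have ni2 m : (- 'i%C : C) ^+ m.*2 = ((-1) ^+ m)%:C.
  by rewrite -mul2n exprM sqrrN sqr_i rmorphXn /= rmorphN1.
have kE := odd_double_half k.
case: (boolP (odd k)) kE => ok kE; rewrite -!exprnP /=.
  rewrite !mul0r scale0r sub0r -scaleNr; congr (_ *: _).
  (* The sine coefficient takes its sign from [k.-1./2], which is [k./2] for odd k. *)
  have -> : k.-1./2 = k./2 by rewrite -{1}kE /= doubleK.
  by rewrite -{1}kE exprS ni2 -[LHS]mulrA RM mulNr mul1r !mulrA.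
rewrite !mul0r mulr0 scale0r subr0; congr (_ *: _).
by rewrite -{1}kE add0n ni2 RM mul1r mulrA.
Qed.

(** Each entry of a partial sum is a fixed linear combination of partial sums of the cosine and sine
    series, so its real and imaginary parts converge separately, as [mxlim] requires. *)
Lemma R_ZZE (t : R) :
  R_ZZ t = (cos (t / 2))%:C *: 1%:M - ('i%C * (sin (t / 2))%:C) *: ZZ.
Proof.
set x := t / 2.
have cc : series (cos_coeff x) @ \oo --> cos x.
  by rewrite cos.unlock; exact: is_cvg_series_cos_coeff.
have cs : series (sin_coeff x) @ \oo --> sin x.
  by rewrite sin.unlock; exact: is_cvg_series_sin_coeff.
have Re_lin (a b : R) (z z' : C) :
    complex.Re (a%:C * z - 'i%C * b%:C * z') = a * complex.Re z + b * complex.Im z'.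
  by case: z => ? ?; case: z' => ? ? /=; ring.
have Im_lin (a b : R) (z z' : C) :
    complex.Im (a%:C * z - 'i%C * b%:C * z') = a * complex.Im z - b * complex.Re z'.
  by case: z => ? ?; case: z' => ? ? /=; ring.
have partial N i j :
    (\sum_(0 <= k < N) (k`!%:R)^-1 *: (- 'i%C * x%:C *: ZZ) ^+ k) i j =
    (series (cos_coeff x) N)%:C * (1%:M : M) i j -
    'i%C * (series (sin_coeff x) N)%:C * ZZ i j.
  rewrite (eq_bigr _ (fun k _ => exp_term x k)) sumrB -!scaler_suml -mulr_sumr.
  by rewrite !mxE -!rmorph_sum.
apply/matrixP => i j; rewrite /R_ZZ /expmx /mxlim mxE -/x.
under eq_fun do rewrite partial Re_lin.
under [X in _ +i* limn X]eq_fun do rewrite partial Im_lin.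
set z := 1%:M i j; set z' := ZZ i j.
have -> : limn (fun N => series (cos_coeff x) N * complex.Re z
    + series (sin_coeff x) N * complex.Im z') =
    cos x * complex.Re z + sin x * complex.Im z'.
  by apply: cvg_lim => //; apply: cvgD; apply: cvgM => //; exact: cvg_cst.
have -> : limn (fun N => series (cos_coeff x) N * complex.Im z
    - series (sin_coeff x) N * complex.Re z') =
    cos x * complex.Im z - sin x * complex.Re z'.
  by apply: cvg_lim => //; apply: cvgB; apply: cvgM => //; exact: cvg_cst.
have -> (a b : C) (A B : M) : (a *: A - b *: B) i j = a * A i j - b * B i j.
  by rewrite !mxE.
by rewrite -Re_lin -Im_lin -/z -/z'; case: (_ - _).
Qed.

Lemma sin_half (t : R) : sin t = (cos (t / 2) * sin (t / 2)) *+ 2.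
Proof. by rewrite -sin_mulr2n -[t / 2 *+ 2]mulr_natr mulfVK ?pnatr_eq0. Qed.

Lemma cos_half (t : R) : cos t = cos (t / 2) ^+ 2 - sin (t / 2) ^+ 2.
Proof.
have {1}-> : t = (t / 2) *+ 2 by rewrite -mulr_natr mulfVK ?pnatr_eq0.
by rewrite cos_mulr2n sin2cos2; ring.
Qed.

(** The half-angle products combine so that the channel is affine in cos t and sin t; mixtures of
    rotations then compare by three coefficients. *)
Lemma unitary_channel_R_ZZ (t : R) (rho : M) :
  unitary_channel (n := 2) (R_ZZ t) rho =
  ((1 + cos t) / 2)%:C *: rho + ((1 - cos t) / 2)%:C *: (ZZ *m rho *m ZZ)
  + ('i%C * (sin t / 2)%:C) *: (rho *m ZZ - ZZ *m rho).
Proof.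
rewrite /unitary_channel R_ZZE -!scaleNr conjtrD !conjtrZ conjtr_ZZ conjtr1.
rewrite (cos_half t) (sin_half t).
have := cos2Dsin2 (t / 2).
set c := cos _; set s := sin _ => cs.
have -> : (1 + (c ^+ 2 - s ^+ 2)) / 2 = c ^+ 2 by lra.
have -> : (1 - (c ^+ 2 - s ^+ 2)) / 2 = s ^+ 2 by lra.
have -> : (c * s) *+ 2 / 2 = c * s by rewrite -mulr_natr mulfK ?pnatr_eq0.
have -> : Num.conj (c%:C) = c%:C by exact: conjc_real.
have -> : Num.conj (- ('i%C * s%:C)) = 'i%C * s%:C.
  by rewrite rmorphN rmorphM /=; simpc.
rewrite !(mulmxDl, mulmxDr) -!scalemxAl -!scalemxAr !mulmx1 !mul1mx !scalerA.
rewrite scalerBr !rmorphM.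
have -> : - ('i%C * s%:C) * ('i%C * s%:C) = s%:C * s%:C.
  by rewrite mulNr mulrACA -expr2 sqr_i; rewrite mulNr mul1r opprK.
rewrite /= [c%:C * ('i%C * _)]mulrCA mulNr -mulrA [s%:C * c%:C]mulrC scaleNr.
by rewrite [X in _ + X = _]addrC addrACA [- _ + _]addrC.
Qed.

Lemma R_ZZ_unitary t : R_ZZ t \is @unitarymx C (2 ^ 2) (2 ^ 2).
Proof.
(* Unitarity is the channel formula at the identity matrix. *)
apply/unitarymxP; have := unitary_channel_R_ZZ t 1%:M.
rewrite /unitary_channel !mulmx1 mul1mx mulZZZZ subrr scaler0 addr0.
rewrite -scalerDl -rmorphD => ->.
have -> : (1 + cos t) / 2 + (1 - cos t) / 2 = 1 by field.
by rewrite scale1r.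
Qed.

(** The orthogonal matrix is the scalar a, a sign: 1 for the identity, -1 for the parity. *)
Lemma gaussian_sign (V : M) (a : R) : V \is unitarymx -> a * a = 1 ->
  (forall j, V *m majorana R j *m V^t* = a%:C *: majorana R j) -> gaussian (n := 2) V.
Proof.
move=> uV aa Vc; split=> //; exists a%:M.
  by rewrite tr_scalar_mx -scalar_mxM aa.
move=> j; rewrite Vc (bigD1 j) //= big1 => [|k /negPf kj].
  by rewrite mxE eqxx mulr1n addr0.
by rewrite mxE eq_sym kj mulr0n scale0r.
Qed.

Lemma gaussian1 : gaussian (n := 2) (1%:M : M).
Proof.
apply: (gaussian_sign (a := 1)); rewrite ?mulr1 //.
  by apply/unitarymxP; rewrite conjtr1 mulmx1.
by move=> j; rewrite conjtr1 mul1mx mulmx1 scale1r.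
Qed.

Lemma gaussian_ZZ : gaussian (n := 2) ZZ.
Proof.
apply: (gaussian_sign (a := -1)); rewrite ?mulrNN ?mulr1 //.
  by apply/unitarymxP; rewrite conjtr_ZZ mulZZZZ.
move=> j; rewrite conjtr_ZZ ZZ_majorana mulNmx -mulmxA mulZZZZ mulmx1.
by rewrite rmorphN1 scaleN1r.
Qed.

Lemma normc_real (r : R) : Normc.normc r%:C = `|r|.
Proof. by rewrite /= expr0n addr0 sqrtr_sqr. Qed.

(** For a sign e this is the parameter w of the witness, i or -i. *)
Definition phase (e : R) : C := 'i%C * e%:C.

Lemma phase_sqr e : e ^+ 2 = 1 -> phase e ^+ 2 = -1.
Proof. by move=> e2; rewrite exprMn sqr_i -rmorphXn e2 mulr1. Qed.

Lemma phase_conj e : Num.conj (phase e) = - phase e.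
Proof. by rewrite /phase rmorphM /=; simpc. Qed.

(** The witness takes the real value cos(t/2) + e sin(t/2), whose square is 1 + e sin t. *)
Lemma witness_R_ZZ e t : e ^+ 2 = 1 ->
  Normc.normc (witness (phase e) (R_ZZ t)) ^+ 2 = 1 + e * sin t.
Proof.
move=> e2; rewrite witnessE R_ZZE -scaleNr mulmxDr -!scalemxAr mulmx1 mulZZZZ.
rewrite !mxtraceD !mxtraceZ mxtrace_ZZ mxtrace1 !mulr0 addr0 add0r.
have -> : (2 ^ 2)%:R = 4 :> C by [].
set c := cos _; set s := sin _.
have -> : 4^-1 * (c%:C * 4 + phase e * (- ('i%C * s%:C) * 4)) = (c + e * s)%:C :> C.
  rewrite rmorphD rmorphM /phase.
  have -> : 4^-1 * (c%:C * 4 + 'i%C * e%:C * (- ('i%C * s%:C) * 4)) =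
      c%:C - 'i%C ^+ 2 * (e%:C * s%:C) :> C by field.
  by rewrite sqr_i mulN1r opprK.
rewrite normc_real real_normK ?num_real //.
rewrite sqrrD exprMn e2 mul1r addrAC cos2Dsin2; congr (_ + _).
by rewrite (sin_half t) mulrnAr mulrCA.
Qed.

Lemma extent_R_ZZ (t : R) : extent (n := 2) (R_ZZ t) = (1 + `|sin t|)%:E.
Proof.
apply/eqP; rewrite eq_le; apply/andP; split; last first.
  (* The lower bound uses the witness whose sign e matches that of sin t. *)
  have [s0|s0] := leP 0 (sin t).
    have := @extent_ge R (phase 1) (R_ZZ t) (phase_sqr (expr1n _ _)) (phase_conj _).
    by rewrite witness_R_ZZ ?expr1n // mul1r (ger0_norm s0).
  have e2 : (-1 : R) ^+ 2 = 1 by rewrite sqrrN expr1n.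
  have := @extent_ge R (phase (-1)) (R_ZZ t) (phase_sqr e2) (phase_conj _).
  by rewrite witness_R_ZZ // mulN1r (ltr0_norm s0).
(* The closed form itself is a Gaussian decomposition; its squared norm (|cos(t/2)| + |sin(t/2)|)^2
   is 1 + |sin t|. *)
pose d : seq (C * M) :=
  [:: ((cos (t / 2))%:C, 1%:M); (- ('i%C * (sin (t / 2))%:C), ZZ)].
have -> : 1 + `|sin t| = l1norm (n := 2) d ^+ 2.
  rewrite /l1norm !big_cons big_nil addr0 -mulNr Normc.normcM normc_real.
  have -> : Normc.normc (- 'i%C : C) = 1.
    by rewrite /= sqrrN expr0n sqrrN expr1n add0r sqrtr1.
  rewrite mul1r normc_real sqrrD !real_normK ?num_real // addrAC cos2Dsin2.
  rewrite -normrM -normrMn; congr (_ + `|_|).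
  by rewrite (sin_half t).
apply: ereal_inf_lbound; exists d => //; split.
  by move=> q; rewrite !inE => /orP[] /eqP ->; [exact: gaussian1|exact: gaussian_ZZ].
by rewrite !big_cons big_nil addr0 R_ZZE scaleNr.
Qed.

End Rotation.

(** * Mixtures of rotations and the cost of decompositions *)

Section Channel.
Local Open Scope classical_set_scope.
Local Open Scope ring_scope.
Local Open Scope complex_scope.
Local Open Scope sesquilinear_scope.
Variable R : realType.
Local Notation C := R[i].
Local Notation M := 'M[C]_(2 ^ 2).
Local Notation ZZ := (ZZ R).

(** The witness average is the same for [d] and [d'], so a known decomposition [d] bounds the cost
    of any other one. *)
Lemma mixture_cost_ge E d d' (e : R) : e ^+ 2 = 1 ->
  mixture_decomposition (n := 2) E d -> mixture_decomposition (n := 2) E d' ->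
  ((\sum_(q <- d) q.1 * Normc.normc (witness (phase e) q.2) ^+ 2)%:E
    <= mixture_cost (n := 2) d')%E.
Proof.
move=> e2 Ed Ed'; rewrite (mixture_witness _ Ed Ed') -sumEFin /mixture_cost.
rewrite big_seq [X in (_ <= X)%E]big_seq; apply: lee_sum => q qd'.
have [/(_ q qd')[q0 _] _ _] := Ed'.
rewrite EFinM; apply: lee_wpmul2l; first by rewrite lee_fin.
by apply: extent_ge; rewrite ?phase_sqr ?phase_conj.
Qed.

(** Meant for the angles phi and pi - phi: they share their sine, hence the witness value, and the
    weights drop out. *)
Lemma sum_pair (f : M -> R) (x y : R) (U V : M) (c : R) :
  f U = c -> f V = c -> x + y = 1 ->
  \sum_(q <- [:: (x, U); (y, V)]) q.1 * f q.2 = c.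
Proof.
by move=> fU fV xy; rewrite !big_cons big_nil addr0 /= fU fV -mulrDl xy mul1r.
Qed.

Lemma mixture_cost_pair (x y : R) (U V : M) (c : R) :
  extent (n := 2) U = c%:E -> extent (n := 2) V = c%:E -> x + y = 1 ->
  mixture_cost (n := 2) [:: (x, U); (y, V)] = c%:E.
Proof.
move=> eU eV xy; rewrite /mixture_cost !big_cons big_nil adde0 /= eU eV.
by rewrite -!EFinM -EFinD -mulrDl xy mul1r.
Qed.

Lemma unitary_channel_ZZ (rho : M) :
  unitary_channel (n := 2) ZZ rho = ZZ *m rho *m ZZ.
Proof. by rewrite /unitary_channel conjtr_ZZ. Qed.

Lemma N_ZZE (theta p : R) (rho : M) :
  N_ZZ theta p rho = (1 - p)%:C *: unitary_channel (n := 2) (R_ZZ theta) rho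
  + p%:C *: (ZZ *m unitary_channel (n := 2) (R_ZZ theta) rho *m ZZ).
Proof. by rewrite -unitary_channel_ZZ. Qed.

Lemma scale_comb3 (S : pzRingType) (V : lmodType S) (u v w : V)
    (x y a b c a' b' c' : S) :
  x *: (a *: u + b *: v + c *: w) + y *: (a' *: u + b' *: v + c' *: w) =
  (x * a + y * a') *: u + (x * b + y * b') *: v + (x * c + y * c') *: w.
Proof.
by rewrite !scalerDr !scalerA !scalerDl addrACA [X in X + _ = _]addrACA.
Qed.

Lemma eq_comb3 (S : pzRingType) (V : lmodType S) (u v w : V) (a b c a' b' c' : S) :
  a = a' -> b = b' -> c = c' ->
  a *: u + b *: v + c *: w = a' *: u + b' *: v + c' *: w.
Proof. by move=> -> -> ->. Qed.

(* [f] is the rotation channel, kept abstract because comparing [R_ZZ] at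
   different angles unfolds [expmx]. *)
Lemma rotation_mixture (f : R -> M -> M) (theta p phi s : R) (rho : M) :
  (forall t, f t rho =
    ((1 + cos t) / 2)%:C *: rho + ((1 - cos t) / 2)%:C *: (ZZ *m rho *m ZZ)
    + ('i%C * (sin t / 2)%:C) *: (rho *m ZZ - ZZ *m rho)) ->
  sin phi = (1 - 2 * p) * sin theta ->
  (2 * s - 1) * cos phi = (1 - 2 * p) * cos theta ->
  (1 - p)%:C *: f theta rho + p%:C *: (ZZ *m f theta rho *m ZZ) =
  s%:C *: f phi rho + (1 - s)%:C *: f (pi - phi) rho.
Proof.
move=> fE sinE cosE; rewrite !fE.
have -> : cos (pi - phi) = - cos phi by rewrite addrC cosDpi cosN.
have -> : sin (pi - phi) = sin phi by rewrite addrC sinDpi sinN opprK.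
set P := ZZ *m rho *m ZZ; set Q := rho *m ZZ - ZZ *m rho.
(* Conjugation by [ZZ] swaps [rho] with [P] and negates the commutator [Q]. *)
have conj_comb (a b c : C) : ZZ *m (a *: rho + b *: P + c *: Q) *m ZZ =
    b *: rho + a *: P + (- c) *: Q.
  rewrite /P /Q !mulmxDr !mulmxDl -!scalemxAr -!scalemxAl !mulmxA mulZZZZ mul1mx.
  rewrite -!mulmxA mulZZZZ mulmx1 !mulmxA mulmxBr mulmxBl !mulmxA mulZZZZ mul1mx.
  rewrite -!mulmxA mulZZZZ mulmx1.
  by rewrite scaleNr -scalerN opprB [a *: _ + _]addrC.
have coef (a b a' b' : R) : (a%:C * b%:C + a'%:C * b'%:C : C) = (a * b + a' * b')%:C.
  by rewrite rmorphD !rmorphM.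
rewrite conj_comb !scale_comb3 !coef.
have pull_i (a b : R) : a%:C * ('i%C * b%:C) = 'i%C * (a * b)%:C :> C.
  by rewrite rmorphM mulrCA.
rewrite mulrN !pull_i -mulrN -!mulrDr -!rmorphN -!rmorphD.
apply: eq_comb3; [congr (_%:C)|congr (_%:C)|congr ('i%C * _%:C)].
(* The first two coefficients agree by [cosE], the third by [sinE]. *)
- by lra.
- by lra.
- by rewrite sinE; lra.
Qed.

Lemma R_ZZ_mixture (theta p phi s : R) :
  0 <= s <= 1 ->
  sin phi = (1 - 2 * p) * sin theta ->
  (2 * s - 1) * cos phi = (1 - 2 * p) * cos theta ->
  mixture_decomposition (n := 2) (N_ZZ theta p)
    [:: (s, R_ZZ phi); (1 - s, R_ZZ (pi - phi))].
Proof.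
move=> /andP[s0 s1] sinE cosE; split.
- move=> q; rewrite !inE => /orP[] /eqP -> /=; split; rewrite ?subr_ge0 //;
    exact: R_ZZ_unitary.
- by rewrite !big_cons big_nil /fst [X in _ + X]addr0 addrC subrK.
move=> rho; rewrite !big_cons big_nil /fst /snd [X in _ + X]addr0 N_ZZE.
apply: (rotation_mixture (f := fun t => unitary_channel (n := 2) (R_ZZ t))) => // t.
exact: unitary_channel_R_ZZ.
Qed.

End Channel.

(** For p > 1/2 the factor 1 - 2p is negative, so the closed form carries its absolute value, which
    is dropped for p at most 1/2. *)
Theorem lemma21 (R : realType) (theta p : R) (hp : 0 <= p <= 1) :
  let phi := asin ((1 - 2 * p) * sin theta) in
  let s := 2^-1 * (1 + (1 - 2 * p) * (cos theta / cos phi)) in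
  [/\ optimal_decomposition (n := 2) (N_ZZ theta p)
        [:: (s, R_ZZ phi); (1 - s, R_ZZ (pi - phi))],
      channel_extent (n := 2) (N_ZZ theta p) = (1 + `|sin phi|)%:E,
      1 + `|sin phi| = 1 + `|1 - 2 * p| * `|sin theta| &
      p <= 2^-1 -> 1 + `|sin phi| = 1 + (1 - 2 * p) * `|sin theta|].
Proof.
move=> phi s.
set k := 1 - 2 * p in phi s *.
have k1 : `|k| <= 1 by rewrite ler_norml /k; lra.
have k2 : k ^+ 2 <= 1 by rewrite -real_normK ?num_real // expr_le1 ?normr_ge0.
have x1 : -1 <= k * sin theta <= 1.
  rewrite -ler_norml normrM -[leRHS]mulr1 ler_pM // ler_norml.
  by rewrite sin_geN1 sin_le1.
have sinE : sin phi = k * sin theta by rewrite /phi asinK // in_itv.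
have cos2 : cos phi ^+ 2 = 1 - (k * sin theta) ^+ 2 by rewrite cos2sin2 sinE.
(* From k^2 at most 1: k^2 - k^2 sin^2 theta is at most 1 - k^2 sin^2 theta. This puts [s] in
   [0, 1]. *)
have kcos : (k * cos theta) ^+ 2 <= cos phi ^+ 2.
  by rewrite cos2 !exprMn cos2sin2; lra.
have ratio : k * (cos theta / cos phi) * cos phi = k * cos theta.
  (* If cos phi = 0, the quotient is 0 by convention (so [s] is 1/2), and [kcos] forces k cos theta
     = 0 too. *)
  have [c0|c0] := eqVneq (cos phi) 0; last by rewrite mulrA divfK.
  move: kcos; rewrite c0 mulr0 expr0n real_exprn_even_le0 ?num_real //= => /eqP ->.
  by [].
have ratio1 : `|k * (cos theta / cos phi)| <= 1.
  have [c0|c0] := eqVneq (cos phi) 0; first by rewrite c0 invr0 !mulr0 normr0.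
  rewrite -(@ler_pXn2r _ 2) ?nnegrE // real_normK ?num_real // expr1n mulrA.
  by rewrite expr_div_n ler_pdivrMr ?mul1r // exprn_even_gt0.
have s01 : 0 <= s <= 1 by move: ratio1; rewrite ler_norml /s; lra.
have mixE : mixture_decomposition (n := 2) (N_ZZ theta p)
    [:: (s, R_ZZ phi); (1 - s, R_ZZ (pi - phi))].
  apply: R_ZZ_mixture => //; rewrite -/k -ratio; congr (_ * _).
  by rewrite /s mulVKf ?pnatr_eq0 // addrC addKr.
have sinpiB : sin (pi - phi) = sin phi by rewrite addrC sinDpi sinN opprK.
have costE : mixture_cost (n := 2) [:: (s, R_ZZ phi); (1 - s, R_ZZ (pi - phi))]
    = (1 + `|sin phi|)%:E.
  apply: mixture_cost_pair; rewrite ?extent_R_ZZ ?sinpiB //.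
  by rewrite addrC subrK.
have extE : channel_extent (n := 2) (N_ZZ theta p) = (1 + `|sin phi|)%:E.
  apply: ereal_inf_min; first by eexists; [exact: mixE|exact: costE].
  move=> _ [d Ed <-].
  (* The sign of sin phi selects the witness that attains 1 + |sin phi| on both rotations. *)
  have [e e2 eE] : exists2 e : R, e ^+ 2 = 1 & `|sin phi| = e * sin phi.
    have [s0|s0] := leP 0 (sin phi).
      by exists 1; rewrite ?expr1n // mul1r ger0_norm.
    by exists (-1); rewrite ?sqrrN ?expr1n // mulN1r ltr0_norm.
  have := mixture_cost_ge e2 mixE Ed.
  rewrite (@sum_pair _ (fun V => Normc.normc (witness (phase e) V) ^+ 2) s (1 - s)
    (R_ZZ phi) (R_ZZ (pi - phi)) (1 + `|sin phi|)) //.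
  - by rewrite witness_R_ZZ // eE.
  - by rewrite witness_R_ZZ // sinpiB eE.
  - by rewrite addrC subrK.
split=> //; first by split=> //; rewrite costE extE.
  by rewrite sinE normrM.
by move=> p2; rewrite sinE normrM (@ger0_norm _ k) // /k; lra.
Qed.
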